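(* Let $G$ be a graph on $n$ nodes with adjacency matrix $A$, $G\neq K_n$ and $G\neq\overline{K_n}$. Let $\mu_{\min}$ and $\mu_{\max}$ be the minimum and maximum eigenvalues of $V^TAV$, with multiplicities $m(\mu_{\min})$ and $m(\mu_{\max})$. Assume that $G$ is neither a cluster graph nor a complete multipartite graph, i.e., $\mu_{\min}\neq -1$ and $\mu_{\max}\neq 0$. Let $Z_l=VU_l$ and $Z_u=VU_u$. Then \[ \dim_S(G)=\begin{cases} n-1 & \text{if } AZ_u\neq\mu_{\min}Z_u \text{ and } AZ_l\neq\mu_{\max}Z_l,\\ n-1-m(\mu_{\min}) & \text{if } AZ_u=\mu_{\min}Z_u \text{ and } AZ_l\neq\mu_{\max}Z_l,\\ n-1-m(\mu_{\max}) & \text{if } AZ_u\neq\mu_{\min}Z_u \text{ and } AZ_l=\mu_{\max}Z_l. \end{cases} \] Otherwise, i.e., if $AZ_u=\mu_{\min}Z_u$ and $AZ_l=\mu_{\max}Z_l$, then \[ \dim_S(G)=\min\{\,n-1-m(\mu_{\min}),\; n-1-m(\mu_{\max})\,\}. \]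
   Context: Graphs are simple. $e$ is the all-ones vector in $\mathbb{R}^n$. $V$ is an $n\times(n-1)$ matrix whose columns form an orthonormal basis of $e^\perp$, i.e. $V^Te=0$ and $V^TV=I_{n-1}$. $U_u$ is an $(n-1)\times m(\mu_{\min})$ matrix, and $U_l$ an $(n-1)\times m(\mu_{\max})$ matrix, whose columns form orthonormal bases of the eigenspaces of $V^TAV$ associated with $\mu_{\min}$ and $\mu_{\max}$, respectively. A Euclidean representation of $G$ in $\mathbb{R}^r$ is a configuration of points $p^1,\ldots,p^n\in\mathbb{R}^r$ for which there are two distinct positive scalars $\alpha\neq\beta$ such that for all $i\neq j$, $\|p^i-p^j\|^2=\alpha$ if $\{i,j\}$ is an edge of $G$, and $\|p^i-p^j\|^2=\beta$ otherwise. It is a spherical representation in $\mathbb{R}^r$ if the points lie on an $(r-1)$-sphere in $\mathbb{R}^r$ (of any radius and center). $\dim_S(G)$ is the smallest $r$ for which $G$ admits a spherical representation in $\mathbb{R}^r$. A cluster graph is a disjoint union of complete graphs (an isolated node $K_1$ counts as complete); a complete multipartite graph is the complement of a cluster graph. For $G\neq K_n,\overline{K_n}$, being a cluster graph is equivalent to $\mu_{\min}=-1$ and being complete multipartite is equivalent to $\mu_{\max}=0$. $\overline{K_n}$ is the null graph (no edges). *)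

(* Defs.v *)
From mathcomp Require Import all_boot all_order all_algebra.
From mathcomp Require Import reals.

Set Implicit Arguments.
Unset Strict Implicit.
Unset Printing Implicit Defensive.

Import Order.TTheory GRing.Theory Num.Theory.
Local Open Scope ring_scope.

Definition is_simple_graph (n : nat) (G : rel 'I_n) : Prop :=
  symmetric G /\ irreflexive G.

Definition is_complete (n : nat) (G : rel 'I_n) : Prop :=
  forall i j, i != j -> G i j.

Definition is_null (n : nat) (G : rel 'I_n) : Prop :=
  forall i j, ~~ G i j.

Definition compl_graph (n : nat) (G : rel 'I_n) : rel 'I_n :=
  fun i j => (i != j) && ~~ G i j.

(* The blocks of P are the node sets of the disjoint complete graphs; an
   isolated node is a block of size 1. *)
Definition is_cluster (n : nat) (G : rel 'I_n) : Prop :=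
  exists2 P : {set {set 'I_n}}, partition P [set: 'I_n] &
    forall i j, G i j = (i != j) && (pblock P i == pblock P j).

Definition is_complete_multipartite (n : nat) (G : rel 'I_n) : Prop :=
  is_cluster (compl_graph G).

Definition adj_mx (R : realType) (n : nat) (G : rel 'I_n) : 'M[R]_n :=
  \matrix_(i, j) (G i j)%:R.

Definition ones (R : realType) (n : nat) : 'cV[R]_n := const_mx 1.

Definition orthonormal_basis_ones_perp (R : realType) (n : nat)
    (V : 'M[R]_(n, n.-1)) : Prop :=
  V^T *m ones R n = 0 /\ V^T *m V = 1%:M.

(* [eigenvalue] and [eigenspace] are about row vectors (v *m M = a *: v). They
   are applied below only to the symmetric matrix V^T A V, for which row and
   column eigenvectors are transposes of each other, and for which geometric
   and algebraic multiplicities coincide. *)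
Definition is_min_eigenvalue (R : realType) (n : nat) (M : 'M[R]_n) (a : R) :
    Prop :=
  eigenvalue M a /\ forall b, eigenvalue M b -> a <= b.

Definition is_max_eigenvalue (R : realType) (n : nat) (M : 'M[R]_n) (a : R) :
    Prop :=
  eigenvalue M a /\ forall b, eigenvalue M b -> b <= a.

Definition eigmult (R : realType) (n : nat) (M : 'M[R]_n) (a : R) : nat :=
  \rank (eigenspace M a).

Definition orthonormal_eigenbasis (R : realType) (n m : nat) (M : 'M[R]_n)
    (a : R) (U : 'M[R]_(n, m)) : Prop :=
  U^T *m U = 1%:M /\ (U^T == eigenspace M a)%MS.

(* The library norm on row vectors is the max norm, hence an explicit sum. *)
Definition sqdist (R : realType) (r : nat) (x y : 'rV[R]_r) : R :=
  \sum_(k < r) (x 0 k - y 0 k) ^+ 2.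

Definition euclidean_rep (R : realType) (n : nat) (G : rel 'I_n) (r : nat)
    (p : 'I_n -> 'rV[R]_r) : Prop :=
  exists alpha beta : R,
    [/\ 0 < alpha, 0 < beta, alpha != beta &
        forall i j, i != j ->
          sqdist (p i) (p j) = if G i j then alpha else beta].

Definition on_sphere (R : realType) (n r : nat) (p : 'I_n -> 'rV[R]_r) : Prop :=
  exists (c : 'rV[R]_r) (rho : R),
    0 < rho /\ forall i, sqdist (p i) c = rho ^+ 2.

Definition has_spherical_rep (R : realType) (n : nat) (G : rel 'I_n) (r : nat) :
    Prop :=
  exists p : 'I_n -> 'rV[R]_r, euclidean_rep G p /\ on_sphere p.

(* dim_S(G) = d, as a relation: it includes that the minimum is attained. *)
Definition is_dimS (R : realType) (n : nat) (G : rel 'I_n) (d : nat) : Prop :=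
  has_spherical_rep R G d /\
  forall r : nat, has_spherical_rep R G r -> (d <= r)%N.

(* Main.v *)
Require Import Defs.
From mathcomp Require Import all_boot all_order all_algebra.
From mathcomp Require Import reals complex spectral sesquilinear.
From mathcomp Require Import ring lra.

Set Implicit Arguments.
Unset Strict Implicit.
Unset Printing Implicit Defensive.

Import Order.TTheory GRing.Theory Num.Theory.
Local Open Scope ring_scope.

(** Write [B = V^T A V] and [e] for the all-ones vector.  A configuration with
    squared distances [alpha] on edges and [beta] on non-edges has squared
    distance matrix [beta e e^T - K], where [K = beta I + (beta - alpha) A].
    By Schoenberg's argument, compressing to the complement of [e] turns [K]
    into twice the Gram matrix of the configuration up to translation: such
    configurations exist in dimension [r] exactly when
    [X = V^T K V = beta I + (beta - alpha) B] is positive semidefinite of rank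
    at most [r].  For the points to lie on a sphere, the squared norms must be
    an affine function of the points, which says that [K V y = 0] whenever
    [X y = 0] ([spherical_rep_necessary], [spherical_rep_sufficient]).

    Put [nu = - beta / (beta - alpha)], so that
    [X = (beta - alpha) (B - nu I)].  If [nu] is not an eigenvalue of [B], then
    [X] has full rank [n - 1].  If it is, positivity forces [nu] to be the
    least eigenvalue of [B] when [alpha < beta] and the greatest when
    [alpha > beta]; the rank is then [n - 1] minus the multiplicity of [nu], and
    the sphere condition says that every eigenvector [y] of [B] for [nu] lifts
    to an eigenvector [V y] of [A] for the same [nu].  So the dimension can
    drop below [n - 1] only at the two extreme eigenvalues, and there only if
    their eigenvectors lift ([spherical_rep_dim]).

    Conversely, the dimension does drop at an extreme eigenvalue [nu] whose
    eigenvectors lift, provided that [nu] comes from positive [alpha] and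
    [beta].  Scaling to [beta - alpha = 1] gives [beta = - nu] and
    [alpha = - nu - 1], so the least eigenvalue must be below [-1]; scaling to
    [beta - alpha = -1] gives [beta = nu] and [alpha = nu + 1], so the greatest
    must be positive.  Both follow from the Rayleigh quotient of
    [delta_a - 2 delta_b + delta_c] on an induced path [a - b - c], which
    exists in [G] because [G] is not a cluster graph, and in its complement
    because [G] is not complete multipartite ([min_eigenvalue_lt],
    [max_eigenvalue_gt0]).  A value of [nu] strictly below the least eigenvalue
    gives a spherical representation in dimension [n - 1] in all cases. *)

(** * Positive semidefinite matrices *)

Section Entries.
Variables (R : pzRingType) (m n : nat) (i : 'I_m) (j : 'I_n).

Lemma entryD (M N : 'M[R]_(m, n)) : (M + N) i j = M i j + N i j.
Proof. by rewrite mxE. Qed.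

Lemma entryN (M : 'M[R]_(m, n)) : (- M) i j = - M i j.
Proof. by rewrite mxE. Qed.

Lemma entryZ a (M : 'M[R]_(m, n)) : (a *: M) i j = a * M i j.
Proof. by rewrite mxE. Qed.

(** Unlike [mxE], these rules leave matrix products folded, so that [ring] can
    treat the entries of products as atoms. *)
Definition entryE := (entryD, entryN, entryZ).

End Entries.

Section QuadraticForms.
Variable R : realFieldType.

Definition qform (n : nat) (S : 'M[R]_n) (x : 'rV_n) : R :=
  (x *m S *m x^T) 0 0.

Definition psd (n : nat) (S : 'M[R]_n) : Prop :=
  S^T = S /\ forall x : 'rV_n, 0 <= qform S x.

Lemma mulmx_tr_ge0 n (x : 'rV[R]_n) : 0 <= (x *m x^T) 0 0.
Proof. by rewrite mxE sumr_ge0 // => i _; rewrite mxE -expr2 sqr_ge0. Qed.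

Lemma mulmx_tr_eq0 n (x : 'rV[R]_n) : (x *m x^T) 0 0 = 0 -> x = 0.
Proof.
rewrite mxE => /eqP; rewrite psumr_eq0 => [/allP x0|i _]; last first.
  by rewrite mxE -expr2 sqr_ge0.
apply/rowP=> i; have := x0 i (mem_index_enum i).
by rewrite !mxE -expr2 sqrf_eq0 => /eqP.
Qed.

Lemma qform1_gt0 n (v : 'rV[R]_n) : v != 0 -> 0 < qform 1%:M v.
Proof.
move=> v0; rewrite /qform mulmx1 lt_def mulmx_tr_ge0 andbT.
by apply: contraNneq v0 => /mulmx_tr_eq0->.
Qed.

Lemma qformN n (S : 'M[R]_n) v : qform (- S) v = - qform S v.
Proof. by rewrite /qform mulmxN mulNmx entryN. Qed.

Lemma qformB_scalar n (S : 'M[R]_n) a v :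
  qform (S - a%:M) v = qform S v - a * qform 1%:M v.
Proof.
by rewrite /qform mulmxBr mulmxBl mulmx1 mul_mx_scalar -scalemxAl !entryE.
Qed.

Lemma bilform_sym n (S : 'M[R]_n) (x z : 'rV_n) :
  S^T = S -> (z *m S *m x^T) 0 0 = (x *m S *m z^T) 0 0.
Proof.
move=> symS; rewrite -[in LHS]symS -[z in LHS]trmxK -!trmx_mul mulmxA.
by rewrite [LHS]mxE.
Qed.

Lemma bilform_delta n (S : 'M[R]_n) (i j : 'I_n) :
  ((delta_mx 0 i : 'rV_n) *m S *m (delta_mx 0 j : 'rV_n)^T) 0 0 = S i j.
Proof. by rewrite -rowE trmx_delta -colE !mxE. Qed.

Lemma qformD n (S : 'M[R]_n) (x z : 'rV_n) k : S^T = S ->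
  qform S (k *: x + z) =
    k ^+ 2 * qform S x + (k * (x *m S *m z^T) 0 0) *+ 2 + qform S z.
Proof.
move=> symS; rewrite /qform linearD linearZ /=.
rewrite !(mulmxDl, mulmxDr) -!(scalemxAl, scalemxAr).
by rewrite !entryE (bilform_sym x z) //; ring.
Qed.

Lemma psd_scale n (S : 'M[R]_n) a : 0 < a -> psd (a *: S) <-> psd S.
Proof.
have scale b (T : 'M[R]_n) : 0 < b -> psd T -> psd (b *: T).
  move=> b0 [symT psdT]; split=> [|x]; first by rewrite linearZ /= symT.
  by rewrite /qform -scalemxAr -scalemxAl entryE mulr_ge0 ?psdT // ltW.
move=> a0; split; last exact: scale.
by move/(scale a^-1); rewrite scalerA mulVf ?gt_eqF // scale1r invr_gt0; apply.
Qed.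

(** Isotropic vectors of a semidefinite form are in its kernel: along the line
    [k x + z] with [z = x S], the form is affine in [k] with slope
    [2 |z|^2], and it stays nonnegative only if this slope vanishes. *)
Lemma psd_ker n (S : 'M[R]_n) (x : 'rV_n) :
  psd S -> qform S x = 0 -> x *m S = 0.
Proof.
move=> [symS psdS] xSx; apply: mulmx_tr_eq0.
set z := x *m S; set w := (z *m z^T) 0 0.
apply/eqP/negPn/negP=> w0.
(* This value of [k] makes the form equal to [-1]. *)
have := psdS ((- (qform S z + 1) / (2 * w)) *: x + z).
rewrite qformD // xSx -/z -/w.
suff -> : forall c : R, (- (c + 1) / (2 * w)) ^+ 2 * 0
   + ((- (c + 1)) / (2 * w) * w) *+ 2 + c = -1 by lra.
by move=> c; field.
Qed.

Lemma psd_gram n k (Q : 'M[R]_(n, k)) : psd (Q *m Q^T).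
Proof.
split=> [|x]; first by rewrite trmx_mul trmxK.
by rewrite /qform mulmxA -mulmxA -trmx_mul mulmx_tr_ge0.
Qed.

Lemma gram_kerl m n k (Q : 'M[R]_(n, k)) (x : 'M_(m, n)) :
  x *m (Q *m Q^T) = 0 -> x *m Q = 0.
Proof.
move=> xQ; apply/row_matrixP=> i; rewrite row0; apply: mulmx_tr_eq0.
by rewrite row_mul trmx_mul mulmxA -(mulmxA _ Q) -row_mul xQ row0 mul0mx mxE.
Qed.

Lemma rank_gram n k (Q : 'M[R]_(n, k)) : \rank (Q *m Q^T) = \rank Q.
Proof.
apply/eqP; rewrite eqn_leq mxrankM_maxl /=.
have: (kermx (Q *m Q^T) <= kermx Q)%MS.
  by apply/sub_kermxP/gram_kerl; rewrite mulmx_ker.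
by move/mxrankS; rewrite !mxrank_ker leq_sub2lE ?rank_leq_row.
Qed.

End QuadraticForms.

Section Factorization.
Variable R : rcfType.

(** Cholesky factorization, by induction on the Schur complement of the
    top-left entry [a].  When [a = 0] the rest of the first row vanishes by
    [psd_ker], so the convention [0^-1 = 0] makes the same formulas valid. *)
Lemma psd_cholesky n (S : 'M[R]_n) : psd S -> exists Q : 'M_n, S = Q *m Q^T.
Proof.
elim: n S => [|n IHn] S psdS.
  by exists 0; apply/matrixP=> -[].
pose a := S 0 0; pose b : 'rV_n := @ursubmx _ 1 n 1 n S.
pose C : 'M_n := @drsubmx _ 1 n 1 n S.
have defS : S = block_mx a%:M b b^T C :> 'M_(1 + n).
  have [symS _] := psdS; rewrite -[LHS](@submxK _ 1 n 1 n); congr block_mx.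
    by rewrite [LHS]mx11_scalar !mxE; congr (S _ _)%:M; apply: val_inj.
  by rewrite -[LHS]trmxK -[S in LHS]symS trmx_dlsub trmxK.
have psdB : @psd _ (1 + n) (block_mx a%:M b b^T C) by rewrite -defS.
have qB (s : R) (y : 'rV_n) :
    @qform _ (1 + n) (block_mx a%:M b b^T C) (row_mx s%:M y)
    = s ^+ 2 * a + (s * (b *m y^T) 0 0) *+ 2 + qform C y.
  rewrite /qform mul_row_block tr_row_mx mul_row_col tr_scalar_mx.
  have -> : (y *m b^T) = (b *m y^T).
    rewrite [RHS]mx11_scalar -tr_scalar_mx -mx11_scalar.
    by rewrite trmx_mul trmxK.
  rewrite !mulmxDl !mul_scalar_mx !mul_mx_scalar scale_scalar_mx.
  by rewrite -scalemxAl !mxE /= mulr1n; ring.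
have qB0 : @qform _ (1 + n) (block_mx a%:M b b^T C) (row_mx 1%:M 0) = a.
  by rewrite qB /qform trmx0 !mulmx0 !mxE mulr0 mul0rn !addr0 expr1n mul1r.
have a_ge0 : 0 <= a by rewrite -qB0 psdB.2.
have b0 : a = 0 -> b = 0.
  move=> a0; have := psd_ker psdB (etrans qB0 a0).
  rewrite mul_row_block !mul1mx !mul0mx !addr0 -[RHS]row_mx0.
  by move/eq_row_mx => [].
have [Q defQ] : exists Q : 'M_n, C - a^-1 *: (b^T *m b) = Q *m Q^T.
  apply: IHn; split.
    rewrite linearB linearZ /= trmx_mul trmxK; congr (_ - _).
    by rewrite /C trmx_drsub (psdS).1.
  (* The first coordinate is the one that minimizes the form of [S]. *)
  move=> y; have := psdB.2 (row_mx (- (a^-1 * (b *m y^T) 0 0))%:M y).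
  rewrite qB /qform mulmxBr mulmxBl -scalemxAr -scalemxAl.
  have -> : y *m (b^T *m b) *m y^T = (b *m y^T)^T *m (b *m y^T).
    by rewrite trmx_mul trmxK !mulmxA.
  rewrite [b *m y^T]mx11_scalar tr_scalar_mx -scalar_mxM !mxE /= !mulr1n.
  set u := \sum_j _; set v := \sum_j _; congr (0 <= _).
  case: (eqVneq a 0) => [->|a0]; first by rewrite invr0; ring.
  by field.
pose T : 'M_(1 + n) :=
  block_mx (Num.sqrt a)%:M 0 ((Num.sqrt a)^-1 *: b^T) Q.
suff defT : block_mx a%:M b b^T C = T *m T^T by exists T; rewrite defS.
rewrite tr_block_mx mulmx_block trmx0 !mul0mx !mulmx0 !addr0.
rewrite -defQ tr_scalar_mx linearZ /= trmxK !(mul_mx_scalar, mul_scalar_mx).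
rewrite -!scalemxAl -!scalemxAr !scalerA scale_scalar_mx -invfM -expr2.
rewrite sqr_sqrtr // addrC subrK.
case: (eqVneq a 0) => [a0|a0]; first by rewrite b0 // trmx0 !scaler0.
by rewrite divff ?scale1r // sqrtr_eq0 -ltNge lt_def a0.
Qed.

(** To use only [\rank S] columns, write a Cholesky factor as [C D] with
    [C] of full column rank, and replace [D] by a square Cholesky factor of the
    smaller matrix [D D^T]. *)
Lemma psd_factor n (S : 'M[R]_n) :
  psd S -> exists Q : 'M_(n, \rank S), S = Q *m Q^T.
Proof.
move=> /psd_cholesky[Q defS].
have [L defL] := psd_cholesky (psd_gram (row_base Q)).
have -> : \rank S = \rank Q by rewrite defS rank_gram.
exists (col_base Q *m L).
rewrite trmx_mul mulmxA -(mulmxA _ L) -defL (mulmxA _ (row_base Q)) mulmx_base.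
by rewrite -mulmxA -trmx_mul mulmx_base.
Qed.

Local Open Scope sesquilinear_scope.

(** Over [R[i]] the matrix is unitarily diagonalizable with a real diagonal,
    and the diagonal entries are real roots of the real characteristic
    polynomial, hence eigenvalues of [S] over [R]. *)
Lemma psd_eigenvalue n (S : 'M[R]_n) : S^T = S ->
  (forall b, eigenvalue S b -> 0 <= b) -> psd S.
Proof.
move=> symS eigS; split=> // x.
pose toC := (@real_complex_def R (Phant R)).
pose SC := map_mx toC S.
have realC m k (M : 'M_(m, k)) : map_mx toC M \is a mxOver Num.real.
  by apply/mxOverP=> i j; rewrite mxE; apply/complex_realP; exists (M i j).
have SCherm : SC \is hermsymmx.
  apply: realsym_hermsym; last exact: realC.
  apply/is_hermitianmxP; rewrite expr0 scale1r map_mx_id //.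
  by rewrite /SC map_trmx symS.
have /orthomx_spectralP := hermitian_normalmx SCherm.
rewrite invmx_unitary ?spectral_unitarymx //.
have := spectral_unitarymx SC; have := hermitian_spectral_diag_real SCherm.
set P := spectralmx SC; set sp := spectral_diag SC => sp_real P_unitary defSC.
have sp_ge0 i : 0 <= sp 0 i.
  have /mxOverP/(_ 0 i)/complex_realP[c defc] := sp_real.
  rewrite defc ler0c; apply: eigS; rewrite -(eigenvalue_map toC).
  apply/eigenvalueP; exists (row i P).
    rewrite -row_mul -/SC defSC !mulmxA (unitarymxP P_unitary) mul1mx.
    by rewrite row_mul row_diag_mx -scalemxAl -rowE defc.
  apply: contraTneq (P_unitary) => Pi0; apply/unitarymxP => /row_matrixP/(_ i).
  rewrite row_mul Pi0 mul0mx => /rowP/(_ i)/eqP.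
  by rewrite !mxE eqxx eq_sym oner_eq0.
rewrite -ler0c.
pose xC := map_mx toC x; pose y := xC *m P ^t*.
have -> : (qform S x)%:C%C = (y *m diag_mx sp *m y ^t*) 0 0.
  rewrite /y trmx_mul map_mxM !mulmxA trmxCK -(mulmxA xC) -(mulmxA xC).
  rewrite -defSC.
  have -> : xC ^t* = map_mx toC x^T by rewrite map_trmx realmxC.
  by rewrite -!map_mxM [RHS]mxE.
rewrite mxE sumr_ge0 // => i _; rewrite mul_mx_diag !mxE mulrAC.
by rewrite mulr_ge0 // mul_conjC_ge0.
Qed.

End Factorization.

Section Shift.
Variables (R : rcfType) (n : nat) (S : 'M[R]_n).
Hypothesis symS : S^T = S.

Lemma psd_shift a : psd (S - a%:M) <-> forall b, eigenvalue S b -> a <= b.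
Proof.
split=> [[_ psdS] b /eigenvalueP[v vS v0]|le_a].
  have := psdS v; rewrite qformB_scalar /qform vS -scalemxAl entryE.
  rewrite -{1}[v]mulmx1 -/(qform 1%:M v) -mulrBl.
  by rewrite pmulr_lge0 ?subr_ge0 // qform1_gt0.
apply: psd_eigenvalue => [|b /eigenvalueP[v vS v0]].
  by rewrite linearB /= symS tr_scalar_mx.
rewrite -(lerD2r a) add0r; apply: le_a; apply/eigenvalueP; exists v => //.
by rewrite scalerDl -vS mulmxBr mul_mx_scalar subrK.
Qed.

End Shift.

Lemma psd_shiftN (R : rcfType) n (S : 'M[R]_n) a : S^T = S ->
  psd (a%:M - S) <-> forall b, eigenvalue S b -> b <= a.
Proof.
move=> symS.
have symN : (- S)^T = - S by rewrite linearN /= symS.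
have eigN b : eigenvalue (- S) b -> eigenvalue S (- b).
  case/eigenvalueP=> v vS v0; apply/eigenvalueP; exists v => //.
  by rewrite scaleNr -vS mulmxN opprK.
have -> : a%:M - S = (- S) - (- a)%:M by rewrite raddfN /= opprK addrC.
split=> [/(psd_shift symN) le_a b Sb|le_a].
  rewrite -lerN2; apply: le_a; case/eigenvalueP: Sb => v vS v0.
  by apply/eigenvalueP; exists v => //; rewrite mulmxN vS scaleNr.
by apply/(psd_shift symN) => b /eigN/le_a; rewrite lerNl.
Qed.

(** * Induced paths *)

(** If no path [a - b - c] were induced, adjacency together with equality would
    be transitive, and its classes would form a cluster partition. *)
Lemma induced_path n (G : rel 'I_n) : is_simple_graph G -> ~ is_cluster G ->
  exists a b c, [/\ G a b, G b c, a != c & ~~ G a c].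
Proof.
move=> [symG irrG] nclG.
case: (boolP [exists a, exists b, exists c,
    [&& G a b, G b c, a != c & ~~ G a c]]) => [|noP3].
  by move=> /existsP[a /existsP[b /existsP[c /and4P[]]]]; exists a, b, c.
case: nclG; pose E : rel 'I_n := fun i j => (i == j) || G i j.
have eqE : {in [set: 'I_n] & &, equivalence_rel E}.
  move=> a b c _ _ _; rewrite /E eqxx; split=> // /orP[/eqP-> //|Gab].
  have Gtr x y z : G x y -> G y z -> (x == z) || G x z.
    move=> Gxy Gyz; apply: contraR noP3; rewrite negb_or => /andP[xz Gxz].
    apply/existsP; exists x; apply/existsP; exists y.
    by apply/existsP; exists z; apply/and4P.
  have Gba : G b a by rewrite symG.
  apply/idP/idP => /orP[/eqP<-|]; [by rewrite Gba orbT|exact: Gtr| |exact: Gtr].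
  by rewrite Gab orbT.
exists (equivalence_partition E [set: 'I_n]).
  exact: equivalence_partitionP.
move=> i j; rewrite eq_pblock; first last.
- by rewrite (cover_partition (equivalence_partitionP eqE)) inE.
- by case/and3P: (equivalence_partitionP eqE).
rewrite pblock_equivalence_partition ?inE // /E.
by case: eqVneq => [->|]; rewrite ?irrG.
Qed.

(** On an induced path [a - b - c] this vector makes the Rayleigh quotient of
    the adjacency matrix [-8 / 6 < -1], and on the complement of such a path it
    makes it [2 / 6 > 0]. *)
Definition path_vec (R : realType) n (a b c : 'I_n) : 'rV[R]_n :=
  delta_mx 0 a - 2 *: delta_mx 0 b + delta_mx 0 c.

Lemma path_vec_ones (R : realType) n (a b c : 'I_n) :
  path_vec R a b c *m ones R n = 0.
Proof.
apply/matrixP=> i j; rewrite /path_vec !mulmxDl mulNmx -scalemxAl -!rowE !mxE.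
by ring.
Qed.

Lemma qform_path_vec (R : realType) n (S : 'M[R]_n) (a b c : 'I_n) : S^T = S ->
  qform S (path_vec R a b c) =
  S a a + 4 * S b b + S c c - 4 * S a b - 4 * S b c + 2 * S a c.
Proof.
move=> symS; have S_sym i j : S j i = S i j by rewrite -[in LHS]symS mxE.
rewrite /qform /path_vec !(linearD, linearN, linearZ) /=.
rewrite -!scaleN1r !scalerA !(mulmxDl, mulmxDr) -!(scalemxAl, scalemxAr).
rewrite !entryE !bilform_delta.
by rewrite (S_sym a b) (S_sym b c) (S_sym a c); ring.
Qed.

(** * Spherical representations and the compressed Schoenberg matrix *)

Section Representations.
Variables (R : realType) (n : nat) (G : rel 'I_n) (V : 'M[R]_(n, n.-1)).
Hypothesis simpleG : is_simple_graph G.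
Hypothesis basisV : orthonormal_basis_ones_perp V.
Let A := adj_mx R G.
Let e := ones R n.

Lemma adj_mx_sym : A^T = A.
Proof. by apply/matrixP=> i j; rewrite !mxE simpleG.1. Qed.

Lemma tr_ones_basis : e^T *m V = 0.
Proof. by rewrite -[V]trmxK -trmx_mul basisV.1 trmx0. Qed.

(** [V V^T] is the orthogonal projection onto the complement of [e], because the
    [n - 1] columns of [V] span that complement. *)
Lemma perp_ones_proj m (w : 'M[R]_(m, n)) : w *m e = 0 -> w *m V *m V^T = w.
Proof.
move=> we; have [Ve VV] := basisV.
have : (w <= V^T)%MS.
  apply: submx_trans (_ : kermx e <= V^T)%MS; first exact/sub_kermxP.
  have VtK : (V^T <= kermx e)%MS by exact/sub_kermxP.
  rewrite -(geq_leqif (mxrank_leqif_sup VtK)) mxrank_ker.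
  have -> : \rank V^T = n.-1.
    apply/eqP; rewrite eqn_leq rank_leq_row /=.
    by rewrite -[X in (X <= _)%N](mxrank1 R n.-1) -VV mxrankM_maxl.
  case: (posnP n) => [n0|n0].
    by rewrite (leq_trans (leq_subr _ _)) // n0.
  rewrite -subn1 leq_sub2l // lt0n mxrank_eq0.
  by apply/eqP=> /matrixP/(_ (Ordinal n0) 0)/eqP; rewrite !mxE oner_eq0.
by case/submxP=> u ->; rewrite -(mulmxA u) VV mulmx1.
Qed.

(** The matrix [K = beta e e^T - D], for [D] the matrix of the squared
    distances [alpha] on edges and [beta] on non-edges. *)
Definition schoenberg_mx (alpha beta : R) : 'M_n :=
  beta%:M + (beta - alpha) *: A.

Lemma compressed_schoenberg_mx alpha beta :
  V^T *m schoenberg_mx alpha beta *m V =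
    beta%:M + (beta - alpha) *: (V^T *m A *m V).
Proof.
have [_ VV] := basisV.
rewrite mulmxDr mulmxDl mul_mx_scalar -scalemxAl VV.
by rewrite -scalemxAr -scalemxAl scalemx1.
Qed.

Lemma sqdistE r (x y : 'rV[R]_r) :
  sqdist x y = (x *m x^T) 0 0 + (y *m y^T) 0 0 - 2 * (x *m y^T) 0 0.
Proof.
rewrite /sqdist !mxE mulr_sumr -big_split -sumrB; apply: eq_bigr => k _ /=.
by rewrite !mxE; ring.
Qed.

Definition config_mx r (p : 'I_n -> 'rV[R]_r) : 'M_(n, r) := \matrix_i p i.

Definition sqnorms r (p : 'I_n -> 'rV[R]_r) : 'cV_n :=
  \col_i (p i *m (p i)^T) 0 0.

(** This is [|x - y|^2 = |x|^2 + |y|^2 - 2 x.y] for all pairs of points at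
    once. *)
Lemma schoenberg_rep r (p : 'I_n -> 'rV[R]_r) alpha beta :
  (forall i j, i != j ->
     sqdist (p i) (p j) = if G i j then alpha else beta) ->
  schoenberg_mx alpha beta = beta *: (e *m e^T) -
    (sqnorms p *m e^T + e *m (sqnorms p)^T) +
    2 *: (config_mx p *m (config_mx p)^T).
Proof.
move=> dp; apply/matrixP=> i j.
have E1 : (e *m e^T) i j = 1 by rewrite mxE big_ord1 !mxE mulr1.
have E2 : (sqnorms p *m e^T) i j = (p i *m (p i)^T) 0 0.
  by rewrite mxE big_ord1 [sqnorms p _ _]mxE !mxE mulr1.
have E3 : (e *m (sqnorms p)^T) i j = (p j *m (p j)^T) 0 0.
  by rewrite mxE big_ord1 [(sqnorms p)^T _ _]mxE [sqnorms p _ _]mxE !mxE mul1r.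
have E4 : (config_mx p *m (config_mx p)^T) i j = (p i *m (p j)^T) 0 0.
  by rewrite !mxE; apply: eq_bigr => k _; rewrite !mxE.
have -> : schoenberg_mx alpha beta i j = beta - sqdist (p i) (p j).
  rewrite !mxE; case: (eqVneq i j) => [<-|ij].
    rewrite simpleG.2 /sqdist big1 => [|k _]; first by rewrite /=; ring.
    by rewrite subrr expr0n.
  by rewrite dp //; case: (G i j) => /=; ring.
by rewrite sqdistE !entryE E1 E2 E3 E4; ring.
Qed.

(** The terms of [schoenberg_rep] that involve [e] vanish on its complement. *)
Lemma schoenberg_rep_compressed r (p : 'I_n -> 'rV[R]_r) alpha beta :
  (forall i j, i != j ->
     sqdist (p i) (p j) = if G i j then alpha else beta) ->
  V^T *m schoenberg_mx alpha beta *m V =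
    2 *: ((V^T *m config_mx p) *m (V^T *m config_mx p)^T).
Proof.
move=> /schoenberg_rep->; have [Ve _] := basisV.
rewrite !(mulmxDr, mulmxDl, mulmxN, mulNmx) -!scalemxAr -!scalemxAl.
rewrite !mulmxA Ve !mul0mx -!mulmxA tr_ones_basis !mulmx0 scaler0.
by rewrite addr0 subr0 add0r trmx_mul trmxK.
Qed.

(** On a sphere, the vector of squared norms is [kappa e + 2 P c] for the
    centre [c] and the matrix [P] of the points, so by [schoenberg_rep] every
    term of [K V Y] contains [e^T V = 0] or [P^T V Y].  The latter vanishes when
    [X Y = 0], because [X] is twice the Gram matrix of [V^T P]. *)
Lemma spherical_rep_necessary r : has_spherical_rep R G r ->
  exists alpha beta : R, let X := V^T *m schoenberg_mx alpha beta *m V in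
    [/\ [/\ 0 < alpha, 0 < beta & alpha != beta], psd X, (\rank X <= r)%N &
        forall m (Y : 'M_(_, m)), X *m Y = 0 ->
          schoenberg_mx alpha beta *m (V *m Y) = 0].
Proof.
move=> [p [[al [be [al0 be0 albe dp]]] [c [rho [_ sp]]]]].
exists al, be => X.
have {X} -> : X = 2 *: ((V^T *m config_mx p) *m (V^T *m config_mx p)^T).
  exact: schoenberg_rep_compressed.
split=> //.
- by apply/psd_scale; [exact: ltr0n | exact: psd_gram].
- rewrite mxrank_scale_nz ?pnatr_eq0 // (leq_trans (mxrankM_maxl _ _)) //.
  exact: rank_leq_col.
move=> m Y; rewrite -scalemxAl => /eqP; rewrite scaler_eq0 pnatr_eq0 /=.
move=> /eqP/(congr1 trmx); rewrite trmx0 trmx_mul (psd_gram _).1 => /gram_kerl.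
move=> /(congr1 trmx); rewrite trmx0 !trmx_mul !trmxK -mulmxA => PVY.
pose kappa := rho ^+ 2 - (c *m c^T) 0 0.
have defd : sqnorms p = kappa *: e + 2 *: (config_mx p *m c^T).
  apply/colP=> i; have := sp i; rewrite sqdistE /kappa => <-.
  have -> : (p i *m c^T) 0 0 = (config_mx p *m c^T) i 0.
    by rewrite !mxE; apply: eq_bigr => k _; rewrite !mxE.
  by rewrite [LHS]mxE !entryE [e _ _]mxE; ring.
rewrite (schoenberg_rep dp) defd.
rewrite !(linearD, linearN, linearZ) /= trmx_mul trmxK.
rewrite !(mulmxDl, scalerN, mulNmx, =^~ scalemxAl) -!mulmxA PVY.
rewrite (mulmxA e^T) tr_ones_basis.
by rewrite !(mul0mx, mulmx0, scaler0, addr0, oppr0).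
Qed.

(** The points are the rows of [P = V Q / sqrt 2]; their squared distances come
    from [K] because differences of basis vectors are orthogonal to [e].  A
    point [c] is equidistant from all of them when [z = d^T - 2 c P^T] is
    constant, [d] being the vector of squared norms, and for this it is enough
    that [z V = 0].  Such a [c] exists as soon as [d^T V] is in the row space of
    [Q^T], that is, vanishes on its kernel; there [schoenberg_rep] reduces
    [K V Y] to [- e (d^T V Y)]. *)
Lemma spherical_rep_sufficient k (Q : 'M_(n.-1, k)) alpha beta :
  (1 < n)%N -> 0 < alpha -> 0 < beta -> alpha != beta ->
  V^T *m schoenberg_mx alpha beta *m V = Q *m Q^T ->
  (forall m (Y : 'M_(_, m)), Q^T *m Y = 0 ->
     schoenberg_mx alpha beta *m (V *m Y) = 0) ->
  has_spherical_rep R G k.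
Proof.
move=> n_gt1 al0 be0 albe defX kerX.
have [Ve VV] := basisV.
pose s : R := (Num.sqrt 2)^-1.
have s2 : 2 * (s * s) = 1.
  by rewrite -expr2 exprVn sqr_sqrtr ?ler0n // divff ?pnatr_eq0.
pose P := s *: (V *m Q).
pose p i := row i P.
have configP : config_mx p = P by apply/matrixP=> i j; rewrite !mxE.
have PP : 2 *: (P *m P^T) =
    V *m (V^T *m schoenberg_mx alpha beta *m V) *m V^T.
  rewrite /P linearZ /= -scalemxAl -scalemxAr !scalerA -mulrA s2 scale1r.
  by rewrite trmx_mul defX !mulmxA.
have dp i j : i != j -> sqdist (p i) (p j) = if G i j then alpha else beta.
  move=> ij; pose w : 'rV[R]_n := delta_mx 0 i - delta_mx 0 j.
  have we : w *m e = 0.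
    by apply/matrixP=> a b; rewrite mulmxDl mulNmx -!rowE !mxE subrr.
  have -> : sqdist (p i) (p j) = (w *m (P *m P^T) *m w^T) 0 0.
    have -> : sqdist (p i) (p j) = ((w *m P) *m (w *m P)^T) 0 0.
      rewrite [RHS]mxE; apply: eq_bigr => l _.
      by rewrite mulmxDl mulNmx -!rowE !mxE expr2.
    by rewrite trmx_mul !mulmxA.
  have : (w *m (2 *: (P *m P^T)) *m w^T) 0 0 =
      (w *m schoenberg_mx alpha beta *m w^T) 0 0.
    rewrite PP !mulmxA -(mulmxA _ V^T w^T) !mulmxA (perp_ones_proj we).
    rewrite -!mulmxA -[w^T in RHS](congr1 trmx (perp_ones_proj we)).
    by rewrite !trmx_mul trmxK !mulmxA.
  rewrite -scalemxAr -scalemxAl mxE => dw.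
  apply: (mulfI (_ : 2 != 0 :> R)); first by rewrite pnatr_eq0.
  rewrite {}dw linearB /= mulmxBr !mulmxBl !entryE !bilform_delta.
  rewrite !mxE !eqxx [j == i]eq_sym (negbTE ij) !simpleG.2 (simpleG.1 j i).
  by case: (G i j) => /=; ring.
have dVY : (sqnorms p)^T *m V *m cokermx Q^T = 0.
  have := kerX _ (cokermx Q^T).
  rewrite mulmx_coker => /(_ erefl).
  rewrite (schoenberg_rep dp) configP /P linearZ /= trmx_mul.
  rewrite !(mulmxDr, mulmxDl, mulmxN, mulNmx) -!scalemxAr -!scalemxAl.
  rewrite -!mulmxA (mulmxA V^T) VV mul1mx mulmx_coker (mulmxA e^T).
  rewrite tr_ones_basis !(mul0mx, mulmx0, scaler0, addr0, add0r, oppr0).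
  move=> /eqP; rewrite oppr_eq0 => /eqP/matrixP edV.
  apply/matrixP=> a b; have := edV (Ordinal (ltnW n_gt1)) b.
  rewrite mxE big_ord1 [e _ _]mxE mul1r mulmxA (ord1 a) => ->.
  by rewrite !mxE.
have /submxP[c0 defc0] : ((sqnorms p)^T *m V <= Q^T)%MS.
  by rewrite submxE dVY.
exists p; split; first by exists alpha, beta.
pose c := s *: c0.
pose z := (sqnorms p)^T - 2 *: (c *m P^T).
have zV : z *m V = 0.
  rewrite mulmxBl defc0 /c /P linearZ /= -!scalemxAl -scalemxAr -scalemxAl.
  by rewrite !scalerA -mulrA s2 scale1r trmx_mul -!mulmxA VV mulmx1 subrr.
pose kappa := (z *m e) 0 0 / n%:R.
have n0 : n%:R != 0 :> R by rewrite pnatr_eq0 -lt0n ltnW.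
have defz : z = kappa *: e^T.
  apply/eqP; rewrite -subr_eq0; apply/eqP.
  rewrite -(perp_ones_proj (_ : (z - kappa *: e^T) *m e = 0)).
    by rewrite mulmxBl -scalemxAl tr_ones_basis zV scaler0 subrr mul0mx.
  rewrite mulmxBl -scalemxAl.
  have -> : e^T *m e = n%:R%:M.
    apply/matrixP=> a b; rewrite !ord1 !mxE eqxx /= mulr1n.
    rewrite (eq_bigr (fun=> 1)) => [|l _]; last by rewrite !mxE mulr1.
    by rewrite sumr_const card_ord.
  by rewrite scale_scalar_mx divfK // -mx11_scalar subrr.
have sp i : sqdist (p i) c = kappa + (c *m c^T) 0 0.
  have : z 0 i = kappa by rewrite defz !mxE mulr1.
  have -> : z 0 i = (p i *m (p i)^T) 0 0 - 2 * (p i *m c^T) 0 0.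
    rewrite !entryE [_^T _ _]mxE [sqnorms p _ _]mxE; congr (_ - _ * _).
    by rewrite !mxE; apply: eq_bigr => l _; rewrite !mxE mulrC.
  by rewrite sqdistE => <-; ring.
have rho_ge0 : 0 <= kappa + (c *m c^T) 0 0.
  by rewrite -(sp (Ordinal (ltnW n_gt1))) sumr_ge0 // => l _; rewrite sqr_ge0.
(* A sphere of radius 0 would make two distinct nodes coincide. *)
have rho0 : kappa + (c *m c^T) 0 0 != 0.
  apply/eqP=> rho0.
  have pc i : p i = c.
    apply/rowP=> l; apply/eqP; rewrite -subr_eq0 -sqrf_eq0.
    have /eqP := sp i; rewrite rho0 psumr_eq0 => [|m _]; last exact: sqr_ge0.
    by move/allP/(_ l (mem_index_enum l)).
  have := dp (Ordinal (ltnW n_gt1)) (Ordinal n_gt1) isT.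
  rewrite !pc /sqdist big1 => [|l _]; last by rewrite subrr expr0n.
  by case: ifP => _ /esym/eqP; rewrite gt_eqF.
exists c, (Num.sqrt (kappa + (c *m c^T) 0 0)); split.
  by rewrite sqrtr_gt0 lt_def rho0.
by move=> i; rewrite sqr_sqrtr.
Qed.

End Representations.

(** * Eigenvalues of the compressed adjacency matrix *)

Section Dimension.
Variables (R : realType) (n : nat) (G : rel 'I_n) (V : 'M[R]_(n, n.-1)).
Hypothesis simpleG : is_simple_graph G.
Hypothesis basisV : orthonormal_basis_ones_perp V.
Let A := adj_mx R G.
Let B := V^T *m A *m V.

(** Basis-free form of the conditions [A Z = mu Z], also meaningful when [nu] is
    not an eigenvalue of [B]: it then holds trivially. *)
Definition eigvec_lifts (nu : R) : Prop :=
  forall m (Y : 'M_(n.-1, m)), B *m Y = nu *: Y ->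
    A *m (V *m Y) = nu *: (V *m Y).

Lemma compressed_adj_sym : B^T = B.
Proof. by rewrite /B !trmx_mul trmxK adj_mx_sym // mulmxA. Qed.

Lemma eigvec_lifts_basis nu m (U : 'M_(n.-1, m)) :
  orthonormal_eigenbasis B nu U ->
  eigvec_lifts nu <-> A *m (V *m U) = nu *: (V *m U).
Proof.
move=> [_ /andP[UE EU]]; split=> [lifts|AU k Y BY].
  apply: lifts; move/eigenspaceP: UE => /(congr1 trmx).
  by rewrite trmx_mul compressed_adj_sym trmxK linearZ /= trmxK.
have : (Y^T <= U^T)%MS.
  apply: submx_trans EU; apply/eigenspaceP.
  by rewrite -compressed_adj_sym -trmx_mul BY linearZ.
case/submxP=> C /(congr1 trmx); rewrite trmxK trmx_mul trmxK => ->.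
by rewrite (mulmxA V) (mulmxA A) AU -scalemxAl.
Qed.

Lemma eigvec_lifts_noneig nu : ~~ eigenvalue B nu -> eigvec_lifts nu.
Proof.
move=> noneig m Y BY.
have : (Y^T <= eigenspace B nu)%MS.
  apply/eigenspaceP; rewrite -[in LHS]compressed_adj_sym -trmx_mul BY.
  by rewrite linearZ.
move: noneig; rewrite negbK => /eqP->; rewrite submx0 -[0]trmx0.
by move=> /eqP/trmx_inj->; rewrite !mulmx0 scaler0.
Qed.

Lemma eigmult_noneig nu : ~~ eigenvalue B nu -> eigmult B nu = 0%N.
Proof. by rewrite negbK /eigmult => /eqP->; rewrite mxrank0. Qed.

Lemma rank_shift nu : \rank (B - nu%:M) = (n.-1 - eigmult B nu)%N.
Proof. by rewrite /eigmult mxrank_ker subKn // rank_leq_row. Qed.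

(** Here [t] stands for [beta - alpha]: the squared distances are
    [beta = - t nu] and [alpha = - t (nu + 1)]. *)
Lemma spherical_rep_schoenberg (nu t : R) :
  (1 < n)%N -> t != 0 -> 0 < - (t * nu) -> 0 < - (t * (nu + 1)) ->
  psd (t *: (B - nu%:M)) -> eigvec_lifts nu ->
  has_spherical_rep R G (n.-1 - eigmult B nu).
Proof.
move=> n1 t0 be0 al0 psdX lifts.
have [Q defX] := psd_factor psdX.
have scB : t *: (B - nu%:M) =
    V^T *m schoenberg_mx G (- (t * (nu + 1))) (- (t * nu)) *m V.
  rewrite compressed_schoenberg_mx // -/A -/B.
  have -> : - (t * nu) - - (t * (nu + 1)) = t by ring.
  by rewrite scalerBr scale_scalar_mx addrC raddfN.
rewrite -rank_shift -(mxrank_scale_nz (B - nu%:M) t0).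
apply: (@spherical_rep_sufficient R n G V simpleG basisV _ Q _ _ n1 al0 be0).
- rewrite -subr_eq0; have -> : - (t * (nu + 1)) - - (t * nu) = - t by ring.
  by rewrite oppr_eq0.
- by rewrite -scB.
move=> m Y QY.
have BY : B *m Y = nu *: Y.
  have : t *: (B - nu%:M) *m Y = 0 by rewrite defX -mulmxA QY mulmx0.
  rewrite -scalemxAl => /eqP; rewrite scaler_eq0 (negbTE t0) /= mulmxBl.
  by rewrite mul_scalar_mx subr_eq0 => /eqP.
rewrite /schoenberg_mx mulmxDl mul_scalar_mx -scalemxAl (lifts _ _ BY).
rewrite scalerA -scalerDl.
have -> : - (t * nu) + (- (t * nu) - - (t * (nu + 1))) * nu = 0 by ring.
by rewrite scale0r.
Qed.

Lemma spherical_rep_below nu : (1 < n)%N -> nu < -1 ->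
  (forall b, eigenvalue B b -> nu <= b) -> eigvec_lifts nu ->
  has_spherical_rep R G (n.-1 - eigmult B nu).
Proof.
move=> n1 nu1 le_nu lifts; apply: (@spherical_rep_schoenberg nu 1) => //.
- exact: oner_neq0.
- by lra.
- by lra.
by rewrite scale1r; apply/psd_shift => //; exact: compressed_adj_sym.
Qed.

Lemma spherical_rep_above nu : (1 < n)%N -> 0 < nu ->
  (forall b, eigenvalue B b -> b <= nu) -> eigvec_lifts nu ->
  has_spherical_rep R G (n.-1 - eigmult B nu).
Proof.
move=> n1 nu1 le_nu lifts; apply: (@spherical_rep_schoenberg nu (-1)) => //.
- by rewrite oppr_eq0 oner_neq0.
- by lra.
- by lra.
rewrite scaleN1r opprB; apply/psd_shiftN => //; exact: compressed_adj_sym.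
Qed.

(** With [nu = - beta / (beta - alpha)], the rank of
    [X = (beta - alpha) (B - nu I)] bounds the dimension from below, and the
    sign of [beta - alpha] decides at which end of the spectrum [nu] lies. *)
Lemma spherical_rep_dim r : has_spherical_rep R G r ->
  (n.-1 <= r)%N \/ exists nu,
    [/\ is_min_eigenvalue B nu \/ is_max_eigenvalue B nu,
        eigvec_lifts nu & (n.-1 - eigmult B nu <= r)%N].
Proof.
move=> /(spherical_rep_necessary simpleG basisV)[al [be []]].
move=> [al0 be0 albe]; rewrite compressed_schoenberg_mx // -/A -/B.
set t := be - al; pose nu := - (be / t).
have t0 : t != 0 by rewrite subr_eq0 eq_sym.
have -> : be%:M + t *: B = t *: (B - nu%:M).
  rewrite scalerBr scale_scalar_mx /nu mulrN mulrCA divff // mulr1 raddfN.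
  by rewrite opprK addrC.
rewrite mxrank_scale_nz // rank_shift => psdX rankX kerX.
case: (boolP (eigenvalue B nu)) => [eig|/eigmult_noneig m0]; last first.
  by left; rewrite m0 subn0 in rankX.
right; exists nu; split=> // [|m Y BY].
  have [tpos|tneg|] := ltgtP 0 t; last by move=> t00; rewrite -t00 eqxx in t0.
    left; split=> //; apply/(psd_shift compressed_adj_sym).
    exact/(psd_scale _ tpos).
  right; split=> //; apply/(psd_shiftN _ compressed_adj_sym).
  rewrite -oppr_gt0 in tneg; apply/(psd_scale _ tneg).
  by rewrite scaleNr -scalerN opprB.
have := kerX _ Y; rewrite -scalemxAl mulmxBl BY mul_scalar_mx subrr scaler0.
move=> /(_ erefl); rewrite /schoenberg_mx -/t -/A mulmxDl mul_scalar_mx.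
rewrite -scalemxAl => /eqP; rewrite addr_eq0 => /eqP E.
have : t^-1 *: (t *: (A *m (V *m Y))) = t^-1 *: - (be *: (V *m Y)).
  by rewrite E opprK.
by rewrite scalerA mulVf // scale1r scalerN scalerA -scaleNr mulrC.
Qed.

Lemma path_vec_compressed a b c :
  let y := path_vec R a b c *m V in
  qform B y = qform A (path_vec R a b c) /\
  qform 1%:M y = qform 1%:M (path_vec R a b c).
Proof.
have proj := perp_ones_proj basisV (path_vec_ones R a b c).
have projT : V *m (V^T *m (path_vec R a b c)^T) = (path_vec R a b c)^T.
  by rewrite -[RHS](congr1 trmx proj) !trmx_mul trmxK.
rewrite /qform !mulmx1 /= trmx_mul /B; split; last by rewrite mulmxA proj.
by rewrite !mulmxA proj -!mulmxA projT.
Qed.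

(** The induced path of a graph that is not a cluster graph gives a Rayleigh
    quotient [-4/3]. *)
Lemma min_eigenvalue_lt mu :
  ~ is_cluster G -> is_min_eigenvalue B mu -> mu < -1.
Proof.
move=> nclG [_ /(psd_shift compressed_adj_sym) psdB].
have [a [b [c [Gab Gbc ac Gac]]]] := induced_path simpleG nclG.
have ab : a != b by apply: contraTneq Gab => ->; rewrite simpleG.2.
have bc : b != c by apply: contraTneq Gbc => ->; rewrite simpleG.2.
have := psdB.2 (path_vec R a b c *m V); rewrite qformB_scalar.
have [-> ->] := path_vec_compressed a b c.
rewrite !qform_path_vec ?trmx1 ?adj_mx_sym // !mxE !simpleG.2 Gab Gbc.
by rewrite (negbTE Gac) !eqxx (negbTE ab) (negbTE bc) (negbTE ac) /=; lra.
Qed.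

(** An induced path [a - b - c] of the complement is in [G] an edge [a - c] with
    a node [b] adjacent to neither end, which gives a Rayleigh quotient
    [1/3]. *)
Lemma max_eigenvalue_gt0 mu :
  ~ is_complete_multipartite G -> is_max_eigenvalue B mu -> 0 < mu.
Proof.
move=> ncmG [_ /(psd_shiftN _ compressed_adj_sym) psdB].
have simpleC : is_simple_graph (compl_graph G).
  by split=> [i j|i]; rewrite /compl_graph ?eqxx // eq_sym simpleG.1.
have [a [b [c [/andP[ab Gab] /andP[bc Gbc] ac]]]] := induced_path simpleC ncmG.
rewrite /compl_graph ac negbK => Gac.
have := psdB.2 (path_vec R a b c *m V); rewrite -opprB qformN qformB_scalar.
have [-> ->] := path_vec_compressed a b c.
rewrite !qform_path_vec ?trmx1 ?adj_mx_sym // !mxE !simpleG.2 Gac.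
rewrite !eqxx (negbTE ab) (negbTE bc) (negbTE ac) (negbTE Gab) (negbTE Gbc) /=.
by lra.
Qed.

End Dimension.

Lemma min_eigenvalue_uniq (R : realType) n (M : 'M[R]_n) a b :
  is_min_eigenvalue M a -> is_min_eigenvalue M b -> a = b.
Proof. by move=> [ea la] [eb lb]; apply: le_anti; rewrite la ?lb. Qed.

Lemma max_eigenvalue_uniq (R : realType) n (M : 'M[R]_n) a b :
  is_max_eigenvalue M a -> is_max_eigenvalue M b -> a = b.
Proof. by move=> [ea la] [eb lb]; apply: le_anti; rewrite la ?lb. Qed.

(** * The spherical dimension *)

Theorem corollary5p3 (R : realType) (n : nat) (G : rel 'I_n)
  (V : 'M[R]_(n, n.-1)) (mu_min mu_max : R)
  (Uu : 'M[R]_(n.-1, eigmult (V^T *m adj_mx R G *m V) mu_min))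
  (Ul : 'M[R]_(n.-1, eigmult (V^T *m adj_mx R G *m V) mu_max)) :
  is_simple_graph G -> ~ is_complete G -> ~ is_null G ->
  ~ is_cluster G -> ~ is_complete_multipartite G ->
  orthonormal_basis_ones_perp V ->
  let A := adj_mx R G in
  let B := V^T *m A *m V in
  is_min_eigenvalue B mu_min -> is_max_eigenvalue B mu_max ->
  orthonormal_eigenbasis B mu_min Uu -> orthonormal_eigenbasis B mu_max Ul ->
  let Zu := V *m Uu in
  let Zl := V *m Ul in
  [/\ A *m Zu <> mu_min *: Zu -> A *m Zl <> mu_max *: Zl ->
        is_dimS R G (n - 1),
      A *m Zu = mu_min *: Zu -> A *m Zl <> mu_max *: Zl ->
        is_dimS R G (n - 1 - eigmult B mu_min),
      A *m Zu <> mu_min *: Zu -> A *m Zl = mu_max *: Zl ->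
        is_dimS R G (n - 1 - eigmult B mu_max) &
      A *m Zu = mu_min *: Zu -> A *m Zl = mu_max *: Zl ->
        is_dimS R G (minn (n - 1 - eigmult B mu_min)
                          (n - 1 - eigmult B mu_max))].
Proof.
move=> simpleG ncomplete _ ncluster nmultipartite basisV A B.
move=> min_mu max_mu basisU basisL Zu Zl; rewrite !subn1.
have n1 : (1 < n)%N.
  rewrite ltnNge; apply/negP=> n1; case: ncomplete => i j /eqP[].
  apply: val_inj.
  have val0 (k : 'I_n) : k = 0%N :> nat.
    by apply/eqP; rewrite -leqn0 -ltnS (leq_trans (ltn_ord k)).
  by rewrite /= !val0.
have mu_min_lt := min_eigenvalue_lt simpleG basisV ncluster min_mu.
have mu_max_gt := max_eigenvalue_gt0 simpleG basisV nmultipartite max_mu.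
have liftU := eigvec_lifts_basis simpleG basisU.
have liftL := eigvec_lifts_basis simpleG basisL.
(* Any [nu] strictly below the spectrum realizes full rank. *)
have rep_full : has_spherical_rep R G n.-1.
  have noneig : ~~ eigenvalue B (mu_min - 1).
    by apply/negP=> /min_mu.2; rewrite lerBrDl gerDr ler10.
  rewrite -[n.-1]subn0 -(eigmult_noneig noneig).
  apply: spherical_rep_below => //; first by lra.
    by move=> b /min_mu.2; lra.
  exact: eigvec_lifts_noneig.
have rep_min : A *m Zu = mu_min *: Zu ->
    has_spherical_rep R G (n.-1 - eigmult B mu_min).
  move/liftU => lifts; apply: spherical_rep_below => //; exact: min_mu.2.
have rep_max : A *m Zl = mu_max *: Zl ->
    has_spherical_rep R G (n.-1 - eigmult B mu_max).
  move/liftL => lifts; apply: spherical_rep_above => //; exact: max_mu.2.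
have lower r : has_spherical_rep R G r -> [\/ (n.-1 <= r)%N,
    A *m Zu = mu_min *: Zu /\ (n.-1 - eigmult B mu_min <= r)%N |
    A *m Zl = mu_max *: Zl /\ (n.-1 - eigmult B mu_max <= r)%N].
  move=> /(spherical_rep_dim simpleG basisV)[|[nu [[]]]].
  - by constructor 1.
  - move=> /min_eigenvalue_uniq/(_ min_mu)->.
    by constructor 2; split=> //; apply/liftU.
  move=> /max_eigenvalue_uniq/(_ max_mu)->.
  by constructor 3; split=> //; apply/liftL.
have sub_r m r : (n.-1 <= r -> n.-1 - m <= r)%N.
  by apply: leq_trans; exact: leq_subr.
split=> [nU nL|eU nL|nU eL|eU eL]; split; auto.
- by move=> r /lower[|[]|[]].
- by move=> r /lower[/sub_r||[]] => // -[].
- by move=> r /lower[/sub_r|[]|] => // -[].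
- by case: leqP => _; auto.
move=> r /lower[/sub_r h|[_]|[_]]; rewrite geq_min ?h // => ->.
  by [].
by rewrite orbT.
Qed.
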